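(* (Local statistical equivalence.) In the two-user MISO broadcast channel with alternating CSIT, let $Z_{pd}(t),Z_{dd}(t)$ be the outputs of receiver 2 at time $t$ corresponding to the CSIT states $\mathsf{PD}$ and $\mathsf{DD}$ (the states in which receiver 2 supplies delayed CSIT), and let $\tilde Z_{pd}(t),\tilde Z_{dd}(t)$ be the corresponding outputs of an artificial receiver with the same input and identically distributed channel and noise (defined in the context). Then for every $t$, $$h\big(Z_{pd}(t),Z_{dd}(t)\,\big|\,Z_{pd}^{t-1},Z_{dd}^{t-1},\Omega\big)=h\big(\tilde Z_{pd}(t),\tilde Z_{dd}(t)\,\big|\,Z_{pd}^{t-1},Z_{dd}^{t-1},\Omega\big).$$
   Context: Channel. A two-antenna transmitter with messages $W_1,W_2$ communicates with two single-antenna receivers over $n$ channel uses. At time $t$ the outputs of receivers 1 and 2 are $Y(t)=\mathbf H_1(t)\mathbf X(t)+N_1(t)$ and $Z(t)=\mathbf H_2(t)\mathbf X(t)+N_2(t)$, with $\mathbf X(t)$ the $2\times1$ complex input, $N_1(t),N_2(t)$ circularly symmetric complex white Gaussian noises with zero mean and unit variance, and $1\times 2$ channel vectors $\mathbf H_1(t),\mathbf H_2(t)$ i.i.d. with continuous distributions and i.i.d. over time. A CSIT state $I_1I_2$ specifies the transmitter's channel knowledge about users 1 and 2: $\mathsf P$ means the user's current channel vector is known perfectly before transmission; $\mathsf D$ means only completely outdated (past) channel information of that user is available, independent of the current realization. In states $\mathsf{PD}$ and $\mathsf{DD}$, the CSIT of user 2 is delayed, so the inputs $\mathbf X_{pd}(t),\mathbf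 X_{dd}(t)$ in these states at time $t$ do not depend on receiver 2's channel vectors at time $t$. Notation. Subscripts $pd$, $dd$ denote quantities corresponding to states $\mathsf{PD}$, $\mathsf{DD}$: $$Z_{pd}(t)=\mathbf H_{2,pd}(t)\mathbf X_{pd}(t)+N_{2,pd}(t),\qquad Z_{dd}(t)=\mathbf H_{2,dd}(t)\mathbf X_{dd}(t)+N_{2,dd}(t),$$ and $Z_{pd}^{t-1},Z_{dd}^{t-1}$ are the sequences of these outputs up to time $t-1$. Let $(\tilde{\mathbf H}_{2,pd}(t),\tilde{\mathbf H}_{2,dd}(t))$ and $(\tilde N_{2,pd}(t),\tilde N_{2,dd}(t))$ be i.i.d. as (independent copies of) $(\mathbf H_{2,pd}(t),\mathbf H_{2,dd}(t))$ and $(N_{2,pd}(t),N_{2,dd}(t))$, respectively; the inputs do not depend on them, and the noises are independent of all other random variables. The artificial outputs are $$\tilde Z_{pd}(t)=\tilde{\mathbf H}_{2,pd}(t)\mathbf X_{pd}(t)+\tilde N_{2,pd}(t),\qquad \tilde Z_{dd}(t)=\tilde{\mathbf H}_{2,dd}(t)\mathbf X_{dd}(t)+\tilde N_{2,dd}(t).$$ $\Omega=(\mathbf H^n,\tilde{\mathbf H}^n)$ is the collection of all channel vectors of both receivers and of the artificial (tilde) receivers up to and including time $n$, and $h(\cdot|\cdot)$ is conditional differential entropy. *)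

(* Defs.v *)
From HB Require Import structures.
From mathcomp Require Import all_boot all_order all_algebra.
From mathcomp Require Import all_classical all_reals all_analysis.
From mathcomp Require Import measurable_realfun complex.

Set Implicit Arguments.
Unset Strict Implicit.
Unset Printing Implicit Defensive.

Import Order.TTheory GRing.Theory Num.Theory.
Import numFieldNormedType.Exports.

Local Open Scope classical_set_scope.
Local Open Scope ring_scope.
Local Open Scope complex_scope.

Definition measure_complex_display : measure_display -> measure_display.
Proof. exact. Qed.

(* [R[i]] carries the sigma-algebra generated by the real and imaginary parts,
   i.e. the Borel sigma-algebra of R^2. *)
Section complex_measurable.
Context (R : realType).

Let Re_ : R[i] -> R := @complex.Re R.
Let Im_ : R[i] -> R := @complex.Im R.

HB.instance Definition _ := isPointed.Build R[i] 0.

Let complex_set0 : g_sigma_preimageU Re_ Im_ set0.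
Proof. exact: sigma_algebra0. Qed.

Let complex_setC A : g_sigma_preimageU Re_ Im_ A ->
  g_sigma_preimageU Re_ Im_ (~` A).
Proof. exact: sigma_algebraC. Qed.

Let complex_bigcup (F : (set R[i])^nat) :
  (forall i, g_sigma_preimageU Re_ Im_ (F i)) ->
  g_sigma_preimageU Re_ Im_ (\bigcup_i (F i)).
Proof. exact: sigma_algebra_bigcup. Qed.

HB.instance Definition _ :=
  @isMeasurable.Build (measure_complex_display default_measure_display) R[i]
    (g_sigma_preimageU Re_ Im_) complex_set0 complex_setC complex_bigcup.

Lemma measurable_Re : measurable_fun [set: R[i]] Re_.
Proof.
by move=> _ A mA; apply: sub_sigma_algebra; left; exists A.
Qed.

Lemma measurable_Im : measurable_fun [set: R[i]] Im_.
Proof.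
by move=> _ A mA; apply: sub_sigma_algebra; right; exists A.
Qed.

Lemma measurable_fun_complexP d (T : measurableType d) (f : T -> R[i]) :
  measurable_fun setT f <->
  measurable_fun setT (Re_ \o f) /\ measurable_fun setT (Im_ \o f).
Proof.
split=> [mf|[mf1 mf2]].
  by split; apply: measurableT_comp => //; [exact: measurable_Re|exact: measurable_Im].
have Hsub : g_sigma_preimageU Re_ Im_ `<=` [set A | measurable (f @^-1` A)].
  apply: smallest_sub; first split.
  - by rewrite /= preimage_set0; exact: measurable0.
  - by move=> A /= mA; rewrite setTD -preimage_setC; exact: measurableC.
  - by move=> F /= mF; rewrite preimage_bigcup; exact: bigcupT_measurable.
  by rewrite subUset; split=> _ [A mA <-] /=;
    rewrite setTI -comp_preimage -[X in measurable X]setTI; [exact: mf1|exact: mf2].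
by move=> _ A /Hsub; rewrite setTI.
Qed.

Lemma measurable_fun_caddmul d (T : measurableType d) (f g : T -> R[i]) :
  measurable_fun setT f -> measurable_fun setT g ->
  measurable_fun setT (fun x => f x + g x) /\
  measurable_fun setT (fun x => f x * g x).
Proof.
move=> /measurable_fun_complexP[f1 f2] /measurable_fun_complexP[g1 g2].
split; apply/measurable_fun_complexP; split.
- rewrite [X in measurable_fun _ X](_ : _ = (Re_ \o f) \+ (Re_ \o g)).
    exact: measurable_funD.
  by apply/funext => x /=; case: (f x) => ? ?; case: (g x).
- rewrite [X in measurable_fun _ X](_ : _ = (Im_ \o f) \+ (Im_ \o g)).
    exact: measurable_funD.
  by apply/funext => x /=; case: (f x) => ? ?; case: (g x).
- rewrite [X in measurable_fun _ X](_ : _ =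
    ((Re_ \o f) \* (Re_ \o g)) \- ((Im_ \o f) \* (Im_ \o g))).
    by apply: measurable_funB; exact: measurable_funM.
  by apply/funext => x /=; case: (f x) => ? ?; case: (g x).
- rewrite [X in measurable_fun _ X](_ : _ =
    ((Re_ \o f) \* (Im_ \o g)) \+ ((Im_ \o f) \* (Re_ \o g))).
    by apply: measurable_funD; exact: measurable_funM.
  by apply/funext => x /=; case: (f x) => ? ?; case: (g x).
Qed.

Definition complex_of_pair (p : measurableTypeR R * measurableTypeR R) : R[i] :=
  p.1 +i* p.2.

Lemma measurable_complex_of_pair : measurable_fun setT complex_of_pair.
Proof.
by apply/measurable_fun_complexP; split; [exact: measurable_fst|exact: measurable_snd].
Qed.

HB.instance Definition _ := isMeasurableFun.Build _ _ _ _ complex_of_pair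
  measurable_complex_of_pair.

End complex_measurable.

Definition measure_ffun_display : measure_display -> measure_display.
Proof. exact. Qed.

(* product sigma-algebra on finite families, as in the library for n.-tuple *)
Section ffun_measurable.
Context d (T : measurableType d) (I : finType).

Definition g_sigma_ffun : set (set {ffun I -> T}) :=
  <<s \bigcup_(i : I)
        preimage_set_system setT (fun f : {ffun I -> T} => f i) measurable >>.

HB.instance Definition _ := isPointed.Build {ffun I -> T} [ffun=> point].

Let ffun_set0 : g_sigma_ffun set0.
Proof. exact: sigma_algebra0. Qed.

Let ffun_setC A : g_sigma_ffun A -> g_sigma_ffun (~` A).
Proof. exact: sigma_algebraC. Qed.

Let ffun_bigcup (F : (set {ffun I -> T})^nat) :
  (forall i, g_sigma_ffun (F i)) -> g_sigma_ffun (\bigcup_i (F i)).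
Proof. exact: sigma_algebra_bigcup. Qed.

HB.instance Definition _ := @isMeasurable.Build (measure_ffun_display d)
  {ffun I -> T} g_sigma_ffun ffun_set0 ffun_setC ffun_bigcup.

Lemma measurable_ffun_proj (i : I) :
  measurable_fun setT (fun f : {ffun I -> T} => f i).
Proof.
by move=> _ A mA; apply: sub_sigma_algebra; exists i => //; exists A.
Qed.

Lemma measurable_fun_ffun d' (U : measurableType d') (f : I -> U -> T) :
  (forall i, measurable_fun setT (f i)) ->
  measurable_fun setT (fun x => [ffun i => f i x]).
Proof.
move=> mf.
have Hsub : g_sigma_ffun `<=`
    [set A | measurable ((fun x => [ffun i => f i x]) @^-1` A)].
  apply: smallest_sub; first split.
  - by rewrite /= preimage_set0; exact: measurable0.
  - by move=> A /= mA; rewrite setTD -preimage_setC; exact: measurableC.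
  - by move=> F /= mF; rewrite preimage_bigcup; exact: bigcupT_measurable.
  move=> _ [i _ [A mA <-]] /=.
  have -> : (fun x => [ffun i => f i x]) @^-1`
      (setT `&` (fun g : {ffun I -> T} => g i) @^-1` A) = setT `&` f i @^-1` A.
    by rewrite !setTI; apply/funext => x; rewrite /preimage/= ffunE.
  exact: mf.
by move=> _ A /Hsub; rewrite setTI.
Qed.

End ffun_measurable.


(* [m1 \x m2] as a sigma-finite measure: the library's instance on [_ \x _] is
   only inferred for subprobabilities, hence this head constant. *)
Section sigma_finite_product.
Local Open Scope ereal_scope.
Context d1 d2 (T1 : measurableType d1) (T2 : measurableType d2) (R : realType).
Variable m1 : {sigma_finite_measure set T1 -> \bar R}.
Variable m2 : {sigma_finite_measure set T2 -> \bar R}.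

Definition sfproduct : set (T1 * T2)%type -> \bar R := m1 \x m2.

Let sfproduct0 : sfproduct set0 = 0.
Proof. exact: measure0. Qed.

Let sfproduct_ge0 A : 0 <= sfproduct A.
Proof. exact: measure_ge0. Qed.

Let sfproduct_sigma_additive : semi_sigma_additive sfproduct.
Proof. exact: measure_semi_sigma_additive. Qed.

HB.instance Definition _ := isMeasure.Build _ _ _ sfproduct
  sfproduct0 sfproduct_ge0 sfproduct_sigma_additive.

Let sfproduct_sigma_finite : sigma_finite setT sfproduct.
Proof.
have /sigma_finiteP[F [TF ndF Foo]] := sigma_finiteT m1.
have /sigma_finiteP[G [TG ndG Goo]] := sigma_finiteT m2.
exists (fun n => F n `*` G n).
  rewrite -setXTT TF TG predeqE => -[x y]; split.
    move=> [/= [n _ Fnx] [k _ Gky]]; exists (maxn n k) => //; split.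
    - by move: x Fnx; exact/subsetPset/ndF/leq_maxl.
    - by move: y Gky; exact/subsetPset/ndG/leq_maxr.
  by move=> [n _ []/= ? ?]; split; exists n.
move=> k; have [? ?] := Foo k; have [? ?] := Goo k.
split; first exact: measurableX.
by rewrite /sfproduct product_measure1E// lte_mul_pinfty// ge0_fin_numE.
Qed.

HB.instance Definition _ := Measure_isSigmaFinite.Build _ _ _ sfproduct
  sfproduct_sigma_finite.

End sigma_finite_product.

Section complex_measures.
Context (R : realType).

Definition clebesgue : set R[i] -> \bar R :=
  pushforward (sfproduct (@lebesgue_measure R) (@lebesgue_measure R))
    (@complex_of_pair R).

Let clebesgue0 : clebesgue set0 = 0%E.
Proof. exact: measure0. Qed.

Let clebesgue_ge0 A : (0 <= clebesgue A)%E.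
Proof. exact: measure_ge0. Qed.

Let clebesgue_sigma_additive : semi_sigma_additive clebesgue.
Proof. exact: measure_semi_sigma_additive. Qed.

HB.instance Definition _ := isMeasure.Build _ _ _ clebesgue
  clebesgue0 clebesgue_ge0 clebesgue_sigma_additive.

Let clebesgue_sigma_finite : sigma_finite setT clebesgue.
Proof.
have [F FT mF] := sigma_finiteT (sfproduct (@lebesgue_measure R) (@lebesgue_measure R)).
pose g (z : R[i]) : measurableTypeR R * measurableTypeR R :=
  (complex.Re z, complex.Im z).
have mg : measurable_fun setT g.
  by apply: measurable_fun_pair; [exact: measurable_Re|exact: measurable_Im].
exists (fun k => g @^-1` F k).
  by rewrite -preimage_bigcup -FT preimage_setT.
move=> k; have [mFk Fk] := mF k; split.
  by rewrite -[X in measurable X]setTI; exact: mg.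
rewrite /clebesgue /pushforward -comp_preimage.
by rewrite (_ : g \o _ = id) ?preimage_id//; apply/funext => -[].
Qed.

HB.instance Definition _ := Measure_isSigmaFinite.Build _ _ _ clebesgue
  clebesgue_sigma_finite.

(* CN(0, 1): independent real and imaginary parts of law N(0, 1/2); the second
   parameter of [normal_prob] is the standard deviation *)
Definition cgauss : set R[i] -> \bar R :=
  pushforward (normal_prob 0 (Num.sqrt 2^-1) \x normal_prob 0 (Num.sqrt 2^-1))%E
    (@complex_of_pair R).

Definition c2lebesgue :
    {sigma_finite_measure set (R[i] * R[i])%type -> \bar R} :=
  sfproduct clebesgue clebesgue.

End complex_measures.

Section joint_rv.
Context d d1 d2 (T : measurableType d) (U : measurableType d1)
  (V : measurableType d2).

Definition joint (X : {mfun T >-> U}) (Y : {mfun T >-> V}) (w : T) : U * V :=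
  (X w, Y w).

Lemma measurable_joint X Y : measurable_fun setT (joint X Y).
Proof. by apply: measurable_fun_pair. Qed.

HB.instance Definition _ X Y := isMeasurableFun.Build _ _ _ _ (joint X Y)
  (@measurable_joint X Y).

(* sigma(X), as a set of events *)
Definition generated_events (X : {mfun T >-> U}) : set (set T) :=
  preimage_set_system setT X measurable.

End joint_rv.

Definition mutually_independent d (T : measurableType d) (R : realType)
    (P : probability T R) (J : finType) (F : J -> set (set T)) : Prop :=
  forall (K : {set J}) (A : J -> set T), (forall j, j \in K -> F j (A j)) ->
    P (\bigcap_(j in [set` K]) A j) = (\prod_(j in K) P (A j))%E.

Section conditional_differential_entropy.
Local Open Scope ereal_scope.
Local Open Scope charge_scope.
Context d d1 d2 (T : measurableType d) (U : measurableType d1)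
  (V : measurableType d2) (R : realType) (P : probability T R).
Variable mu : {sigma_finite_measure set U -> \bar R}.

(* the conditional density f(x|y) of X given Y w.r.t. the reference measure mu:
   P_{X,Y}(dx, dy) = f(x|y) mu(dx) P_Y(dy) *)
Definition cond_density (X : {RV P >-> U}) (Y : {RV P >-> V}) :
    U * V -> \bar R :=
  'd (charge_of_finite_measure (distribution P (joint X Y)))
    '/d (sfproduct mu (distribution P Y)).

(* h(X|Y) = - E[log f(X|Y)], in nats *)
Definition cond_diff_entropy (X : {RV P >-> U}) (Y : {RV P >-> V}) : \bar R :=
  - \int[P]_w lne (cond_density X Y (X w, Y w)).

End conditional_differential_entropy.

Variant csit := Perfect | Delayed.

Definition bool_of_csit c := if c is Perfect then true else false.
Definition csit_of_bool b := if b then Perfect else Delayed.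

Lemma bool_of_csitK : cancel bool_of_csit csit_of_bool. Proof. by case. Qed.

HB.instance Definition _ := Equality.copy csit (can_type bool_of_csitK).
HB.instance Definition _ := Choice.copy csit (can_type bool_of_csitK).
HB.instance Definition _ := Countable.copy csit (can_type bool_of_csitK).
HB.instance Definition _ := Finite.copy csit (can_type bool_of_csitK).

Variant user := User1 | User2.

Definition bool_of_user u := if u is User1 then true else false.
Definition user_of_bool b := if b then User1 else User2.

Lemma bool_of_userK : cancel bool_of_user user_of_bool. Proof. by case. Qed.

HB.instance Definition _ := Equality.copy user (can_type bool_of_userK).
HB.instance Definition _ := Choice.copy user (can_type bool_of_userK).
HB.instance Definition _ := Countable.copy user (can_type bool_of_userK).
HB.instance Definition _ := Finite.copy user (can_type bool_of_userK).

Definition state := (csit * csit)%type.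
Definition PD : state := (Perfect, Delayed).
Definition DD : state := (Delayed, Delayed).

Definition csit_of (u : user) (s : state) : csit :=
  if u is User1 then s.1 else s.2.

(* [inl (u, s)] is user u in state s; [inr c] is the artificial copy of user 2
   in the state (c, Delayed), so that [inr Perfect] and [inr Delayed] are the
   artificial receivers of PD and DD. *)
Definition receiver := (user * state + csit)%type.

Definition rx2 (s : state) : receiver := inl (User2, s).
Definition artificial (c : csit) : receiver := inr c.

Definition state_of (r : receiver) : state :=
  match r with inl (_, s) => s | inr c => (c, Delayed) end.

(* Each of the n time indices carries one channel use per CSIT state. *)
Definition link n := (receiver * 'I_n)%type.
Definition user_link n := (user * state * 'I_n)%type.

Definition real_link n (l : user_link n) : link n := (inl l.1, l.2).

(* What the input in state s at time t may depend on: all past channel vectors,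
   and a current channel vector of user u only if the CSIT of u is perfect (both
   in s and in the state of that vector). *)
Definition csit_known n (s : state) (t : 'I_n) (l : user_link n) : bool :=
  let: (u, s', t') := l in
  (t' < t)%N ||
  [&& t' == t, csit_of u s == Perfect & csit_of u s' == Perfect].

Section misobc.
Context d (T : measurableType d) (R : realType) (P : probability T R).
Context (n : nat).
Context d1 d2 (M1 : measurableType d1) (M2 : measurableType d2).

(* Channel and input vectors are pairs of complex numbers, one per antenna.
   The third argument of an encoder lists the channel vectors of the users,
   those unknown to the transmitter being replaced by 0 (see [input]). *)
Record misobc := MisoBC {
  msg1 : {RV P >-> M1} ;
  msg2 : {RV P >-> M2} ;
  channel : link n -> {RV P >-> (R[i] * R[i])%type} ;
  noise : link n -> {RV P >-> R[i]} ;
  encoder : state -> 'I_n ->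
    {mfun (M1 * M2 * {ffun user_link n -> (R[i] * R[i])%type})%type
      >-> (R[i] * R[i])%type} }.

Variable B : misobc.

Definition csit_view (s : state) (t : 'I_n) (w : T) :
    {ffun user_link n -> (R[i] * R[i])%type} :=
  [ffun l => if csit_known s t l then channel B (real_link l) w else 0].

Lemma measurable_csit_view s t : measurable_fun setT (csit_view s t).
Proof.
apply: (@measurable_fun_ffun _ _ (user_link n) _ _
  (fun l w => if csit_known s t l then channel B (real_link l) w else 0)) => l.
by case: csit_known.
Qed.

HB.instance Definition _ s t := isMeasurableFun.Build _ _ _ _ (csit_view s t)
  (@measurable_csit_view s t).

Definition input (s : state) (t : 'I_n) (w : T) : R[i] * R[i] :=
  encoder B s t (msg1 B w, msg2 B w, csit_view s t w).

Lemma measurable_input s t : measurable_fun setT (input s t).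
Proof.
apply: (measurableT_comp (f := encoder B s t)) => //.
by apply: measurable_fun_pair => //; exact: measurable_fun_pair.
Qed.

HB.instance Definition _ s t := isMeasurableFun.Build _ _ _ _ (input s t)
  (@measurable_input s t).

Definition output (r : receiver) (t : 'I_n) (w : T) : R[i] :=
  let h := channel B (r, t) w in
  let x := input (state_of r) t w in
  h.1 * x.1 + h.2 * x.2 + noise B (r, t) w.

Lemma measurable_output r t : measurable_fun setT (output r t).
Proof.
have m1 (f : T -> R[i] * R[i]) : measurable_fun setT f ->
  measurable_fun setT (fun w => (f w).1).
  by move=> mf; apply: (measurableT_comp (f := fst)).
have m2 (f : T -> R[i] * R[i]) : measurable_fun setT f ->
  measurable_fun setT (fun w => (f w).2).
  by move=> mf; apply: (measurableT_comp (f := snd)).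
have D f g mf mg := (@measurable_fun_caddmul R _ T f g mf mg).1.
have M f g mf mg := (@measurable_fun_caddmul R _ T f g mf mg).2.
by apply: (D) => //; apply: (D); apply: (M);
  do ?[apply: m1|apply: m2] => //; exact: measurable_input.
Qed.

HB.instance Definition _ r t := isMeasurableFun.Build _ _ _ _ (output r t)
  (@measurable_output r t).

Definition past_outputs (r : receiver) (t : 'I_n) (w : T) : t.-tuple R[i] :=
  [tuple output r (widen_ord (ltnW (ltn_ord t)) k) w | k < t].

Lemma measurable_past_outputs r t : measurable_fun setT (past_outputs r t).
Proof.
apply/measurable_fun_tnthP => k.
rewrite (_ : _ \o _ = output r (widen_ord (ltnW (ltn_ord t)) k)).
  exact: measurable_output.
by apply/funext => w /=; rewrite tnth_mktuple.
Qed.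

HB.instance Definition _ r t := isMeasurableFun.Build _ _ _ _
  (past_outputs r t) (@measurable_past_outputs r t).

(* Omega: it includes the channel vectors of the artificial receivers and those
   of the times after the current one *)
Definition all_channels (w : T) : {ffun link n -> (R[i] * R[i])%type} :=
  [ffun l => channel B l w].

Lemma measurable_all_channels : measurable_fun setT all_channels.
Proof. by apply: (measurable_fun_ffun (f := fun l w => channel B l w)). Qed.

HB.instance Definition _ := isMeasurableFun.Build _ _ _ _
  all_channels measurable_all_channels.

(* No independence between the two messages is needed: the pair (W1, W2) is one
   source. *)
Definition sources (j : option (link n + link n)) : set (set T) :=
  match j with
  | None => generated_events (joint (msg1 B) (msg2 B))
  | Some (inl l) => generated_events (channel B l)
  | Some (inr l) => generated_events (noise B l)
  end.

Record misobc_hypotheses (muH : probability (R[i] * R[i])%type R) : Prop := {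
  (* "continuous distribution": the common law has a density on C^2 *)
  channel_law : forall l A, measurable A -> distribution P (channel B l) A = muH A ;
  channel_continuous : muH `<< c2lebesgue R ;
  noise_law : forall l A, measurable A -> distribution P (noise B l) A = @cgauss R A ;
  sources_independent : mutually_independent P sources }.

End misobc.

(* Main.v *)
(* Exchange, at time t only, the links of receiver 2 in the states PD and DD
   with those of the artificial receivers.  The channel vectors are i.i.d. over
   all links, so are the noises, and both are independent of the messages, so
   the joint law of these sources is invariant under the exchange.  Since the
   CSIT of user 2 is delayed in both states, the inputs up to time t and the past
   outputs do not change either.  Hence (Z(t), past, Omega) and
   (Z~(t), past, sigma(Omega)) have the same law, where sigma permutes the
   components of Omega.  Finally, conditioning on Omega or on sigma(Omega) gives
   the same entropy, as sigma is a measurable involution. *)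

From HB Require Import structures.
Require Import Defs.
From mathcomp Require Import all_boot all_order all_algebra.
From mathcomp Require Import all_classical all_reals all_analysis.
From mathcomp Require Import measurable_realfun complex.

Set Implicit Arguments.
Unset Strict Implicit.
Unset Printing Implicit Defensive.

Import Order.TTheory GRing.Theory Num.Theory.

Local Open Scope classical_set_scope.
Local Open Scope ring_scope.

(** * Measurability of the logarithm and integration against an image measure *)

Lemma measurable_lne (R : realType) : measurable_fun [set: \bar R] (@lne R).
Proof.
pose g (x : \bar R) : \bar R := if (+oo <= x)%E then +oo%E else
  if (x <= 0)%E then -oo%E else (ln (fine x))%:E.
have -> : @lne R = g.
  by apply/funext => -[r| |]; rewrite /g ?leey ?leNye ?lee_fin ?leye_eq /=.
apply: measurable_fun_ifT => //.
  by apply: (@measurable_fun_lee _ _ R setT (cst +oo%E) id).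
apply: measurable_fun_ifT => //.
  by apply: (@measurable_fun_lee _ _ R setT id (cst 0%E)).
apply/measurable_EFinP; apply: measurableT_comp; [exact: measurable_ln|].
exact: fine_measurable.
Qed.

(** The integral is the difference of those of the positive and negative parts, and each is
    transported by the nonnegative case. This covers functions that are not integrable, as the
    entropies may be infinite. *)
Lemma integral_pushforward_measurable d1 d2 (T1 : measurableType d1)
    (T2 : measurableType d2) (R : realType)
    (m : {measure set T1 -> \bar R}) (phi : {mfun T1 >-> T2})
    (f : T2 -> \bar R) D :
  measurable D -> measurable_fun setT f ->
  (\int[pushforward m phi]_(y in D) f y =
   \int[m]_(x in phi @^-1` D) f (phi x))%E.
Proof.
move=> mD mf.
transitivity (\int[pushforward m phi]_(y in D) f^\+ y -
    \int[pushforward m phi]_(y in D) f^\- y)%E; first exact: integralE.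
transitivity (\int[m]_(x in phi @^-1` D) (f \o phi)^\+ x -
    \int[m]_(x in phi @^-1` D) (f \o phi)^\- x)%E; last exact/esym/integralE.
rewrite (funepos_comp f phi) (funeneg_comp f phi).
congr (_ - _)%E; apply: (ge0_integral_pushforward _ _ mD).
- exact: measurable_funPT.
- exact/measurable_funTS/measurable_funepos.
- by move=> y _; exact: funepos_ge0.
- exact: measurable_funPT.
- exact/measurable_funTS/measurable_funeneg.
- by move=> y _; exact: funeneg_ge0.
Qed.

(** * Conditional entropy under an involution of the conditioning variable *)

Section entropy_change_of_variables.
Local Open Scope ereal_scope.
Local Open Scope charge_scope.
Context d d1 d2 (T : measurableType d) (U : measurableType d1)
  (V : measurableType d2) (R : realType) (P : probability T R).
Variable mu : {sigma_finite_measure set U -> \bar R}.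
Variables (X X' : {RV P >-> U}) (Y : {RV P >-> V}).
Variables (phi : {mfun V >-> V}) (phiK : involutive phi).

Definition comp_rv (w : T) : V := phi (Y w).

Lemma measurable_comp_rv : measurable_fun setT comp_rv.
Proof. exact: measurableT_comp. Qed.

HB.instance Definition _ := isMeasurableFun.Build _ _ _ _ comp_rv
  measurable_comp_rv.

Definition apply_snd (z : U * V) : U * V := (z.1, phi z.2).

Lemma measurable_apply_snd : measurable_fun setT apply_snd.
Proof.
by apply: measurable_fun_pair => //; apply: measurableT_comp.
Qed.

HB.instance Definition _ := isMeasurableFun.Build _ _ _ _ apply_snd
  measurable_apply_snd.

Lemma apply_sndK : involutive apply_snd.
Proof. by case=> u v; rewrite /apply_snd/= phiK. Qed.

Lemma preimage_apply_sndK A : apply_snd @^-1` (apply_snd @^-1` A) = A.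
Proof.
rewrite -comp_preimage (_ : apply_snd \o apply_snd = id)//.
exact/funext/apply_sndK.
Qed.

Hypothesis law : forall A, measurable A ->
  distribution P (joint X Y) A = distribution P (joint X' comp_rv) A.

(** Since [phi] is an involution, [apply_snd] turns [(X', phi(Y))] back into [(X', Y)]. *)
Lemma law_joint_apply_snd A : measurable A ->
  distribution P (joint X Y) (apply_snd @^-1` A) =
  distribution P (joint X' Y) A.
Proof.
move=> mA; rewrite law; last exact: measurable_funPTI.
rewrite /distribution /pushforward; congr (P _).
by apply/funext => w; rewrite /preimage/= /joint /apply_snd/= /comp_rv phiK.
Qed.

(** Evaluating [law_joint_apply_snd] on cylinders removes [X] and [X'] and leaves the law of [Y] on
    both sides. *)
Lemma law_phi A : measurable A ->
  distribution P Y (phi @^-1` A) = distribution P Y A.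
Proof.
move=> mA.
have mA2 : measurable (setT `*` A : set (U * V)) by exact: measurableX.
transitivity (distribution P (joint X' Y) (apply_snd @^-1` (setT `*` A))).
  rewrite /distribution /pushforward; congr (P _).
  by apply/seteqP; split => w //= [].
rewrite -law_joint_apply_snd; last exact: measurable_funPTI.
rewrite /distribution /pushforward; congr (P _).
rewrite preimage_apply_sndK.
by apply/seteqP; split => w //= [].
Qed.

Let rho := sfproduct mu (distribution P Y).

(** The first component is fixed, so each section is pulled back by [phi], which preserves the law
    of [Y]. *)
Lemma sfproduct_apply_snd A : measurable A -> rho (apply_snd @^-1` A) = rho A.
Proof.
move=> mA; apply: eq_integral => u _ /=.
rewrite -[RHS]law_phi; last exact: measurable_xsection.
congr (distribution P Y _); apply/funext => v.
Qed.

(** [apply_snd] exchanges the two laws and preserves the null sets of [rho]. Hence either both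
    conditional densities are genuine or neither is. *)
Lemma dominates_apply_snd :
  distribution P (joint X Y) `<< rho <-> distribution P (joint X' Y) `<< rho.
Proof.
have mS A : measurable A -> measurable (apply_snd @^-1` A).
  by move=> mA; exact: measurable_funPTI.
split=> /null_content_dominatesP H; apply/null_content_dominatesP => A mA rA.
- rewrite -law_joint_apply_snd//; apply: H; first exact: mS.
  exact: etrans (sfproduct_apply_snd mA) rA.
- rewrite -(preimage_apply_sndK A).
  rewrite law_joint_apply_snd; last exact: mS.
  by apply: H; [exact: mS|exact: etrans (sfproduct_apply_snd mA) rA].
Qed.

(** Uniqueness of densities: over each measurable set, both sides integrate to the law of
    [(X', Y)]. *)
Lemma ae_eq_cond_density_apply_snd : distribution P (joint X Y) `<< rho ->
  ae_eq rho setT (cond_density mu X' Y) (cond_density mu X Y \o apply_snd).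
Proof.
move=> dom; have /dominates_apply_snd dom' := dom.
have mf : measurable_fun setT (cond_density mu X Y).
  by apply: measurable_int; exact: Radon_Nikodym_integrable.
apply: integral_ae_eq => //.
- exact: Radon_Nikodym_integrable.
- exact: measurableT_comp.
move=> A _ mA.
have mA' : measurable (apply_snd @^-1` A).
  exact: measurable_funPTI.
rewrite -[in RHS](preimage_apply_sndK A).
rewrite -(integral_pushforward_measurable rho apply_snd mA' mf).
transitivity (\int[rho]_(z in apply_snd @^-1` A) cond_density mu X Y z);
  last first.
  by apply: eq_measure_integral => B mB _; exact/esym/sfproduct_apply_snd.
have RN (X0 : {RV P >-> U}) D : distribution P (joint X0 Y) `<< rho ->
    measurable D ->
    distribution P (joint X0 Y) D = \int[rho]_(z in D) cond_density mu X0 Y z.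
  exact: (@Radon_Nikodym_integral _ _ _ (charge_of_finite_measure _)
    (sfproduct mu (distribution P Y))).
rewrite -RN// -RN//.
exact/esym/law_joint_apply_snd.
Qed.

(** Under domination, the entropy integrates the log-density of [X] given [Y] against the law of
    [(X, Y)]. That law is the image by [apply_snd] of the law of [(X', Y)], and the density composed
    with [apply_snd] is that of [X'] given [Y]. *)
Theorem cond_diff_entropy_change_of_variables :
  cond_diff_entropy mu X Y = cond_diff_entropy mu X' Y.
Proof.
rewrite /cond_diff_entropy; congr (- _).
have [dom|ndom] := pselect (distribution P (joint X Y) `<< rho); last first.
  (* without absolute continuity both densities are the junk constant -oo *)
  have ndom' : ~ distribution P (joint X' Y) `<< rho.
    by move/dominates_apply_snd.
  by apply: eq_integral => w _; rewrite /cond_density /Radon_Nikodym;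
    case: pselect => // ?; case: pselect.
have /dominates_apply_snd dom' := dom.
have mlne (X0 : {RV P >-> U}) : distribution P (joint X0 Y) `<< rho ->
    measurable_fun setT (@lne R \o cond_density mu X0 Y).
  move=> dom0; apply: measurableT_comp; first exact: measurable_lne.
  by apply: measurable_int; exact: Radon_Nikodym_integrable.
have mf := mlne _ dom; have mf' := mlne _ dom'.
transitivity
    (\int[distribution P (joint X Y)]_z (@lne R \o cond_density mu X Y) z).
  exact/esym/integral_pushforward_measurable.
transitivity
    (\int[distribution P (joint X' Y)]_z (@lne R \o cond_density mu X' Y) z);
  last exact/integral_pushforward_measurable.
transitivity (\int[distribution P (joint X' Y)]_z
    ((@lne R \o cond_density mu X Y) \o apply_snd) z).
  transitivity (\int[pushforward (distribution P (joint X' Y)) apply_snd]_z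
      (@lne R \o cond_density mu X Y) z);
    last exact: integral_pushforward_measurable.
  by apply: eq_measure_integral => A mA _; exact: law.
apply: ae_eq_integral => //; first exact: measurableT_comp.
(* The exceptional set is null for [rho], while the integrals are against the law of [(X', Y)];
   domination makes it null there too. *)
have [N [mN N0 HN]] := ae_eq_cond_density_apply_snd dom.
exists N; split => //.
  by move/null_content_dominatesP : dom'; apply.
move=> z Hz; apply: HN => /= h; apply: Hz => _ /=.
by rewrite h.
Qed.

End entropy_change_of_variables.

(** * The exchange of receiver 2 with the artificial receivers *)

Definition swap_receiver (r : receiver) : receiver :=
  match r with
  | inl (User2, (c, Delayed)) => inr c
  | inr c => inl (User2, (c, Delayed))
  | _ => r
  end.

Lemma swap_receiverK : involutive swap_receiver.
Proof. by case=> [[[] [[] []]]|[]]. Qed.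

(** Exchanged receivers thus observe the same input. *)
Lemma state_of_swap_receiver r : state_of (swap_receiver r) = state_of r.
Proof. by case: r => // -[[] [c []]]. Qed.

Definition swap_link n (t : 'I_n) (l : link n) : link n :=
  if l.2 == t then (swap_receiver l.1, l.2) else l.

Lemma swap_linkK n (t : 'I_n) : involutive (swap_link t).
Proof.
case=> r k; rewrite /swap_link /=; case kt: (k == t) => /=; rewrite kt //.
by rewrite swap_receiverK.
Qed.

(** * Messages, channel vectors and noises as one random variable *)

Section all_sources.
Context d (T : measurableType d) (R : realType) (P : probability T R).
Context (n : nat).
Context d1 d2 (M1 : measurableType d1) (M2 : measurableType d2).
Implicit Types B : misobc P n M1 M2.

(** The same encoders now act on the permuted channel vectors, so the inputs need not be those of
    [B]. *)
Definition relink (sigma : link n -> link n) B : misobc P n M1 M2 :=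
  MisoBC (msg1 B) (msg2 B) (fun l => channel B (sigma l))
    (fun l => noise B (sigma l)) (encoder B).

Definition all_noises B (w : T) : {ffun link n -> R[i]} :=
  [ffun l => noise B l w].

Lemma measurable_all_noises B : measurable_fun setT (all_noises B).
Proof. by apply: (measurable_fun_ffun (f := fun l w => noise B l w)). Qed.

HB.instance Definition _ B := isMeasurableFun.Build _ _ _ _
  (all_noises B) (@measurable_all_noises B).

Definition all_sources B :=
  joint (joint (joint (msg1 B) (msg2 B)) (all_channels B)) (all_noises B).

HB.instance Definition _ B := MeasurableFun.on (all_sources B).

End all_sources.

(** * The pi-system of rectangles in the space of source values *)

Section source_rectangle.
Context (R : realType) (n : nat) d1 d2 (M1 : measurableType d1)
  (M2 : measurableType d2).
Local Notation S := (M1 * M2 * {ffun link n -> (R[i] * R[i])%type} *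
  {ffun link n -> R[i]})%type.

Definition source_rectangle (A : set (M1 * M2))
    (X : link n -> set (R[i] * R[i])) (N : link n -> set R[i]) : set S :=
  [set e : S | [/\ A e.1.1, forall l, X l (e.1.2 l) & forall l, N l (e.2 l)]].

Definition source_rectangles : set (set S) :=
  [set E | exists A X N, [/\ measurable A, forall l, measurable (X l),
    forall l, measurable (N l) & E = source_rectangle A X N]].

Lemma source_rectangles_setI_closed : setI_closed source_rectangles.
Proof.
move=> _ _ [A [X [N [mA mX mN ->]]]] [A' [X' [N' [mA' mX' mN' ->]]]].
exists (A `&` A'), (fun l => X l `&` X' l), (fun l => N l `&` N' l); split.
- exact: measurableI.
- by move=> l; exact: measurableI.
- by move=> l; exact: measurableI.
apply/seteqP; split=> e /=.
  by move=> [[a b c] [a' b' c']].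
by move=> [[a a'] b c]; split; split=> // l; case: (b l); case: (c l).
Qed.

Lemma source_rectangles_setT : source_rectangles setT.
Proof.
exists setT, (fun=> setT), (fun=> setT); split=> //.
by apply/seteqP; split.
Qed.

Lemma measurable_source_rectangles : source_rectangles `<=` measurable.
Proof.
move=> _ [A [X [N [mA mX mN ->]]]].
have m1 : measurable_fun setT (fun e : S => e.1.1) by apply: measurableT_comp.
have m2 : measurable_fun setT (fun e : S => e.1.2) by apply: measurableT_comp.
have m3 : measurable_fun setT (fun e : S => e.2) by exact: measurable_snd.
rewrite (_ : source_rectangle A X N = (fun e : S => e.1.1) @^-1` A `&`
  (\bigcap_(l in setT) ((fun e : S => e.1.2 l) @^-1` X l) `&`
   \bigcap_(l in setT) ((fun e : S => e.2 l) @^-1` N l))).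
  apply: measurableI; first by rewrite -[X in measurable X]setTI; exact: m1.
  apply: measurableI; apply: fin_bigcap_measurable => [|l _];
    try exact: finite_finset; rewrite -[X in measurable X]setTI.
  - by apply: (measurableT_comp (measurable_ffun_proj l) m2).
  - by apply: (measurableT_comp (measurable_ffun_proj l) m3).
apply/seteqP; split=> e /=.
  by move=> [a b c]; split=> //; split=> l _; [exact: b|exact: c].
by move=> [a [b c]]; split=> // l; [exact: b|exact: c].
Qed.

Lemma measurable_sources_generated :
  @measurable _ S = <<s source_rectangles >>.
Proof.
apply/seteqP; split; last first.
  apply: smallest_sub; first exact: sigma_algebra_measurable.
  exact: measurable_source_rectangles.
pose G := g_sigma_algebraType source_rectangles.
have mrect A X N : measurable A -> (forall l, measurable (X l)) ->
    (forall l, measurable (N l)) ->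
    @measurable _ G (source_rectangle A X N).
  by move=> mA mX mN; apply: sub_sigma_algebra; exists A, X, N.
have m1 : measurable_fun setT (fun e : G => e.1.1).
  move=> _ A mA; rewrite setTI.
  rewrite (_ : _ @^-1` _ = source_rectangle A (fun=> setT) (fun=> setT)).
    exact: mrect.
  by apply/seteqP; split=> e //= [].
have m2 l : measurable_fun setT (fun e : G => e.1.2 l).
  move=> _ A mA; rewrite setTI.
  rewrite (_ : _ @^-1` _ = source_rectangle setT
    (fun l' => if l' == l then A else setT) (fun=> setT)).
    by apply: mrect => // l'; case: ifP.
  apply/seteqP; split=> e /=.
    by move=> Ae; split=> // l'; case: eqP => // ->.
  by move=> [_ /(_ l)]; rewrite eqxx.
have m3 l : measurable_fun setT (fun e : G => e.2 l).
  move=> _ A mA; rewrite setTI.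
  rewrite (_ : _ @^-1` _ = source_rectangle setT (fun=> setT)
    (fun l' => if l' == l then A else setT)).
    by apply: mrect => // l'; case: ifP.
  apply/seteqP; split=> e /=.
    by move=> Ae; split=> // l'; case: eqP => // ->.
  by move=> [_ _ /(_ l)]; rewrite eqxx.
(* Rebuilding a point from its coordinates is the identity. Its measurability from [G] to the
   product sigma-algebra is the inclusion sought. *)
have mid : measurable_fun setT
    (fun e : G => (e.1.1, [ffun l => e.1.2 l], [ffun l => e.2 l]) : S).
  apply: measurable_fun_pair; first apply: measurable_fun_pair => //.
  - exact: measurable_fun_ffun.
  - exact: measurable_fun_ffun.
move=> A mA; have := mid measurableT A mA; rewrite setTI.
congr (<<s source_rectangles >> _); apply/funext => -[[m h] z].
rewrite /preimage/=.
by congr (A (_, _, _)); apply/ffunP => l; rewrite ffunE.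
Qed.

End source_rectangle.

(** * Invariance of the joint law of the sources *)

Section relink_law.
Context d (T : measurableType d) (R : realType) (P : probability T R).
Context (n : nat).
Context d1 d2 (M1 : measurableType d1) (M2 : measurableType d2).
Implicit Types B : misobc P n M1 M2.

Definition source_preimage B (A : set (M1 * M2))
    (X : link n -> set (R[i] * R[i])) (N : link n -> set R[i])
    (j : option (link n + link n)) : set T :=
  match j with
  | None => joint (msg1 B) (msg2 B) @^-1` A
  | Some (inl l) => channel B l @^-1` X l
  | Some (inr l) => noise B l @^-1` N l
  end.

(** Independence is applied to all sources at once, the event of each being one side of the
    rectangle. *)
Lemma source_rectangle_law B muH A X N : misobc_hypotheses B muH ->
  measurable A -> (forall l, measurable (X l)) ->
  (forall l, measurable (N l)) ->
  distribution P (all_sources B) (source_rectangle A X N) =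
  (\prod_j P (source_preimage B A X N j))%E.
Proof.
move=> [_ _ _ indep] mA mX mN.
have := indep finset.setT (source_preimage B A X N).
have mpre j : j \in finset.setT -> sources B j (source_preimage B A X N j).
  case: j => [[l|l]|] _ /=.
  - by exists (X l); rewrite ?setTI.
  - by exists (N l); rewrite ?setTI.
  - by exists A; rewrite ?setTI.
move=> /(_ mpre); under eq_bigl do rewrite inE.
move=> <-; congr (P _); apply/seteqP; split=> w.
  move=> [/= a b c] [[l|l]|] _ //=.
  - by have := b l; rewrite ffunE.
  - by have := c l; rewrite ffunE.
move=> h; split=> [|l|l] /=.
- by apply: (h None); rewrite /= inE.
- by rewrite ffunE; apply: (h (Some (inl l))); rewrite /= inE.
- by rewrite ffunE; apply: (h (Some (inr l))); rewrite /= inE.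
Qed.

(** Two probabilities that agree on a generating pi-system are equal; on rectangles both are
    products over the sources, whose factors match because all links share the same laws. *)
Lemma relink_law B muH sigma : misobc_hypotheses B muH -> involutive sigma ->
  forall A, measurable A ->
  distribution P (all_sources B) A =
  distribution P (all_sources (relink sigma B)) A.
Proof.
move=> H sigmaK A mA.
apply: (measure_unique (@source_rectangles R n _ _ M1 M2) (fun=> setT)) => //.
- exact: measurable_sources_generated.
- exact: source_rectangles_setI_closed.
- by move=> _; exact: source_rectangles_setT.
- by rewrite bigcup_const.
- move=> _ [{}A [X [N [{}mA mX mN ->]]]].
  (* As [sigma] is an involution, permuting the links amounts to permuting the sides of the
     rectangle. *)
  transitivity (distribution P (all_sources B)
      (source_rectangle A (X \o sigma) (N \o sigma))); last first.
    congr (P _); apply/seteqP; split=> w [/= a b c]; split=> //= l.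
    + by rewrite ffunE; have := b (sigma l); rewrite /= ffunE sigmaK.
    + by rewrite ffunE; have := c (sigma l); rewrite /= ffunE sigmaK.
    + by rewrite ffunE; have := b (sigma l); rewrite /= ffunE /= sigmaK.
    + by rewrite ffunE; have := c (sigma l); rewrite /= ffunE /= sigmaK.
  transitivity (\prod_j P (source_preimage B A X N j))%E.
    exact: (source_rectangle_law H).
  transitivity (\prod_j P (source_preimage B A (X \o sigma) (N \o sigma) j))%E;
    last first.
    by apply/esym/(source_rectangle_law H) => // l; [exact: mX|exact: mN].
  pose tau (j : option (link n + link n)) := match j with
    | Some (inl l) => Some (inl (sigma l))
    | Some (inr l) => Some (inr (sigma l))
    | None => None end.
  have tauK : involutive tau by move=> [[l|l]|] //=; rewrite sigmaK.
  (* After reindexing, both factors at a link [l] concern the same side, [X (sigma l)] or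
     [N (sigma l)], and differ only in the link, [sigma l] or [l], whose source must lie in it. *)
  rewrite [LHS](reindex_inj (inv_inj tauK)) /=.
  case: H => lawH _ lawN _; apply: eq_bigr => -[[l|l]|] _ //=.
  + by rewrite -[LHS]/(distribution P _ _) -[RHS]/(distribution P _ _) !lawH.
  + by rewrite -[LHS]/(distribution P _ _) -[RHS]/(distribution P _ _) !lawN.
- move=> _; rewrite [X in (X < _)%E](_ : _ = 1%E) ?ltry//.
  exact: probability_setT.
Qed.

End relink_law.

(** * Outputs as functions of the sources *)

Section canonical_channel.
Context d (T : measurableType d) (R : realType) (P : probability T R).
Context (n : nat).
Context d1 d2 (M1 : measurableType d1) (M2 : measurableType d2).
Local Notation S := (M1 * M2 * {ffun link n -> (R[i] * R[i])%type} *
  {ffun link n -> R[i]})%type.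
Implicit Types B : misobc P n M1 M2.
Implicit Types Q : probability S R.

Definition source_msg1 (e : S) : M1 := e.1.1.1.
Definition source_msg2 (e : S) : M2 := e.1.1.2.
Definition source_channel (l : link n) (e : S) : R[i] * R[i] := e.1.2 l.
Definition source_noise (l : link n) (e : S) : R[i] := e.2 l.

Lemma measurable_source_msg1 : measurable_fun setT source_msg1.
Proof. by apply: measurableT_comp => //; apply: measurableT_comp. Qed.

Lemma measurable_source_msg2 : measurable_fun setT source_msg2.
Proof. by apply: measurableT_comp => //; apply: measurableT_comp. Qed.

Lemma measurable_source_channel l : measurable_fun setT (source_channel l).
Proof.
apply: (measurableT_comp (measurable_ffun_proj l)).
by apply: measurableT_comp.
Qed.

Lemma measurable_source_noise l : measurable_fun setT (source_noise l).
Proof. exact: (measurableT_comp (measurable_ffun_proj l) measurable_snd). Qed.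

HB.instance Definition _ := isMeasurableFun.Build _ _ _ _ source_msg1
  measurable_source_msg1.
HB.instance Definition _ := isMeasurableFun.Build _ _ _ _ source_msg2
  measurable_source_msg2.
HB.instance Definition _ l := isMeasurableFun.Build _ _ _ _ (source_channel l)
  (@measurable_source_channel l).
HB.instance Definition _ l := isMeasurableFun.Build _ _ _ _ (source_noise l)
  (@measurable_source_noise l).

(* The channel with the same encoders over the space of source values: composing
   its outputs with [all_sources] gives back those of [B], so that the law of
   the latter is determined by the law of [all_sources B]. *)
Definition canonical_misobc Q B : misobc Q n M1 M2 :=
  MisoBC source_msg1 source_msg2 source_channel source_noise (encoder B).

Lemma csit_view_canonical Q B s t w :
  csit_view (canonical_misobc Q B) s t (all_sources B w) = csit_view B s t w.
Proof. by apply/ffunP => l; rewrite !ffunE /= /source_channel /= ffunE. Qed.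

Lemma input_canonical Q B s t w :
  input (canonical_misobc Q B) s t (all_sources B w) = input B s t w.
Proof. by rewrite /input csit_view_canonical. Qed.

Lemma output_canonical Q B r t w :
  output (canonical_misobc Q B) r t (all_sources B w) = output B r t w.
Proof.
rewrite /output input_canonical /= /source_channel /source_noise /=.
by rewrite !ffunE.
Qed.

Lemma past_outputs_canonical Q B r t w :
  past_outputs (canonical_misobc Q B) r t (all_sources B w) =
  past_outputs B r t w.
Proof. by apply: eq_from_tnth => k; rewrite !tnth_mktuple output_canonical. Qed.

Lemma all_channels_canonical Q B w :
  all_channels (canonical_misobc Q B) (all_sources B w) = all_channels B w.
Proof. by apply/ffunP => l; rewrite !ffunE /= /source_channel /= ffunE. Qed.

End canonical_channel.

Section delayed_outputs.
Context d (T : measurableType d) (R : realType) (P : probability T R).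
Context (n : nat).
Context d1 d2 (M1 : measurableType d1) (M2 : measurableType d2).

Definition delayed_outputs (B : misobc P n M1 M2) (t : 'I_n) :=
  joint (joint (output B (rx2 PD) t) (output B (rx2 DD) t))
    (joint (joint (past_outputs B (rx2 PD) t) (past_outputs B (rx2 DD) t))
      (all_channels B)).

HB.instance Definition _ B t := MeasurableFun.on (delayed_outputs B t).

End delayed_outputs.

Section delayed_outputs_law.
Context d (T : measurableType d) (R : realType) (P : probability T R).
Context (n : nat).
Context d1 d2 (M1 : measurableType d1) (M2 : measurableType d2).
Implicit Types B : misobc P n M1 M2.

Lemma delayed_outputs_canonical Q B t w :
  delayed_outputs (canonical_misobc Q B) t (all_sources B w) =
  delayed_outputs B t w.
Proof.
congr ((_, _), ((_, _), _)).
- exact: output_canonical.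
- exact: output_canonical.
- exact: past_outputs_canonical.
- exact: past_outputs_canonical.
- exact: all_channels_canonical.
Qed.

(** Both sides are laws of the same function [F] of the sources, and [relink_law] equates the laws
    of the sources. *)
Lemma delayed_outputs_relink_law B muH sigma t A : misobc_hypotheses B muH ->
  involutive sigma -> measurable A ->
  distribution P (delayed_outputs B t) A =
  distribution P (delayed_outputs (relink sigma B) t) A.
Proof.
move=> hypB sigmaK mA.
pose Q := distribution P (all_sources B).
pose F := delayed_outputs (canonical_misobc Q B) t.
have mFA : measurable (F @^-1` A).
  exact: (measurable_funPTI F).
transitivity (distribution P (all_sources B) (F @^-1` A)).
  congr (P _); apply/funext => w; congr (A _).
  exact/esym/delayed_outputs_canonical.
rewrite (relink_law hypB sigmaK mFA).
congr (P _); apply/funext => w; congr (A _).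
(* Relinking keeps the encoders, so [B] and [relink sigma B] have the same canonical channel. *)
exact: (delayed_outputs_canonical Q (relink sigma B)).
Qed.

End delayed_outputs_law.

(** * Effect of the exchange on inputs and outputs *)

Section swap.
Context d (T : measurableType d) (R : realType) (P : probability T R).
Context (n : nat).
Context d1 d2 (M1 : measurableType d1) (M2 : measurableType d2).
Variables (B : misobc P n M1 M2) (t : 'I_n).

Let B' := relink (swap_link t) B.

Lemma swap_link_past r (k : 'I_n) : (k < t)%N -> swap_link t (r, k) = (r, k).
Proof. by move=> kt; rewrite /swap_link /= -val_eqE /= ltn_eqF. Qed.

(** Delayed CSIT enters here. A visible link is either earlier than [k], hence untouched, or belongs
    to user 1 at time [k], and the exchange fixes user 1. A current link of user 2 is visible only
    with perfect CSIT in [s]. *)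
Lemma csit_view_swap s (k : 'I_n) w : (k <= t)%N -> s.2 = Delayed ->
  csit_view B' s k w = csit_view B s k w.
Proof.
move=> kt sD; apply/ffunP => l; rewrite !ffunE; case: ifP => // known.
case: l known => [[u s'] k'] /= /orP[k'k|].
  by rewrite swap_link_past// (leq_trans k'k).
case: u; first by rewrite /real_link /swap_link /=; case: ifP.
by rewrite /= sD andbC.
Qed.

Lemma input_swap s (k : 'I_n) w : (k <= t)%N -> s.2 = Delayed ->
  input B' s k w = input B s k w.
Proof. by move=> kt sD; rewrite /input csit_view_swap. Qed.

Lemma output_swap_past r (k : 'I_n) w : (k < t)%N -> (state_of r).2 = Delayed ->
  output B' r k w = output B r k w.
Proof.
by move=> kt rD; rewrite /output input_swap ?(ltnW kt)//= swap_link_past.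
Qed.

(** The input is unchanged, while the channel vector and the noise at time [t] become those of the
    exchanged receiver. *)
Lemma output_swap r w : (state_of r).2 = Delayed ->
  output B' r t w = output B (swap_receiver r) t w.
Proof.
move=> rD; rewrite /output input_swap//= state_of_swap_receiver.
by rewrite /swap_link /= eqxx.
Qed.

Lemma past_outputs_swap r w : (state_of r).2 = Delayed ->
  past_outputs B' r t w = past_outputs B r t w.
Proof.
move=> rD; apply: eq_from_tnth => k; rewrite !tnth_mktuple.
by apply: output_swap_past => /=.
Qed.

End swap.

(** * Permutation of Omega and conclusion *)

Section permute_links.
Context (R : realType) (n k : nat) (sigma : link n -> link n).
Local Notation V := (k.-tuple R[i] * k.-tuple R[i] *
  {ffun link n -> (R[i] * R[i])%type})%type.

(** This is the [phi] of the entropy theorem; the past outputs are left in place. *)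
Definition permute_links (v : V) : V := (v.1, [ffun l => v.2 (sigma l)]).

Lemma measurable_permute_links : measurable_fun setT permute_links.
Proof.
apply: measurable_fun_pair; first exact: measurable_fst.
apply: (measurable_fun_ffun (f := fun l (v : V) => v.2 (sigma l))) => l.
exact: (measurableT_comp (measurable_ffun_proj (sigma l)) measurable_snd).
Qed.

HB.instance Definition _ := isMeasurableFun.Build _ _ _ _ permute_links
  measurable_permute_links.

Lemma permute_linksK : involutive sigma -> involutive permute_links.
Proof.
move=> sigmaK [z h]; rewrite /permute_links /=; congr (_, _).
by apply/ffunP => l; rewrite !ffunE sigmaK.
Qed.

End permute_links.

Theorem mainTheorem4 (R : realType) (d : measure_display) (T : measurableType d)
    (P : probability T R) (n : nat)
    (d1 d2 : measure_display) (M1 : measurableType d1) (M2 : measurableType d2)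
    (B : misobc P n M1 M2) (muH : probability (R[i] * R[i])%type R)
    (channelB : misobc_hypotheses B muH) (t : 'I_n) :
  let Z s := output B (rx2 s) t in
  let Ztilde c := output B (artificial c) t in
  let Zpast s := past_outputs B (rx2 s) t in
  let given := joint (joint (Zpast PD) (Zpast DD)) (all_channels B) in
  cond_diff_entropy (P := P) (c2lebesgue R) (joint (Z PD) (Z DD)) given =
  cond_diff_entropy (P := P) (c2lebesgue R)
    (joint (Ztilde Perfect) (Ztilde Delayed)) given.
Proof.
have swapK := @swap_linkK n t.
(* It remains to equate the laws of the true outputs with the past and Omega, and of the artificial
   ones with the past and the permuted Omega. *)
apply: (@cond_diff_entropy_change_of_variables _ _ _ _ _ _ _ _ _ _ _ _
  (permute_links (swap_link t)) (permute_linksK swapK)) => A mA.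
rewrite -[LHS]/(distribution P (delayed_outputs B t) A).
rewrite (delayed_outputs_relink_law channelB swapK mA).
(* Once the channel is relinked, the two random variables agree pointwise, component by
   component. *)
congr (P _); apply/funext => w; congr (A ((_, _), ((_, _), _))).
- exact: output_swap.
- exact: output_swap.
- exact: past_outputs_swap.
- exact: past_outputs_swap.
- by apply/ffunP => l; rewrite !ffunE.
Qed.
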